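(* If $\kappa$ is an infinite cardinal and $K$ is a product of $\kappa$ many compact spaces with at least two points, then $\mathfrak{Dau}(C(K))\geq\kappa$.
   Context: All topological spaces are Hausdorff and all Banach spaces are real; $C(K)$ is the space of real continuous functions on $K$ with the sup norm. Each of the $\kappa$ many factors is a compact space having at least two points. $B_X$ and $S_X$ denote the closed unit ball and unit sphere of a Banach space $X$. A slice of $B_X$ is a nonempty intersection of $B_X$ with an open half-space, i.e. a set $\{x\in B_X: f(x)>\sup f(B_X)-\alpha\}$ with $f\in X^*$, $\alpha>0$. For a cardinal $\kappa$, $\{y_\alpha:\alpha<\kappa\}$ denotes a set of cardinality at most $\kappa$. $X$ has the $\kappa$-Daugavet property if for every family $\{y_\alpha:\alpha<\kappa\}\subseteq S_X$, every slice $S$ of $B_X$ and every $\varepsilon>0$ there is $x\in S$ with $\|y_\alpha+x\|>2-\varepsilon$ for all $\alpha<\kappa$. For nonzero $X$, $\mathfrak{Dau}(X)$ is the least cardinal $\kappa$ such that $X$ fails the $\kappa$-Daugavet property. *)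

(* Defs.v *)
From HB Require Import structures.
From mathcomp Require Import all_boot all_order all_algebra.
From mathcomp Require Import all_classical all_reals all_analysis.

Set Implicit Arguments.
Unset Strict Implicit.
Unset Printing Implicit Defensive.

Import Order.TTheory GRing.Theory Num.Theory.
Import numFieldNormedType.Exports.

Local Open Scope classical_set_scope.
Local Open Scope card_scope.
Local Open Scope ring_scope.

Section Daugavet.
Context {R : realType} (V : normedModType R).

Definition unit_ball : set V := [set x | `|x| <= 1].
Definition unit_sphere : set V := [set x | `|x| = 1].

Definition is_slice (S : set V) : Prop :=
  exists (f : {scalar V}) (a : R), [/\ continuous (f : V -> R), 0 < a &
    S = [set x | unit_ball x /\ sup [set f y | y in unit_ball] - a < f x]].

(* A cardinal is given by any set D having it. The set A is the family        *)
(* {y_alpha : alpha < kappa}, a set of cardinality at most kappa.             *)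
Definition daugavet_property (T : Type) (D : set T) : Prop :=
  forall A : set V, A `<=` unit_sphere -> A #<= D ->
  forall S : set V, is_slice S ->
  forall e : R, 0 < e ->
  exists2 x : V, S x & forall y, A y -> 2 - e < `|y + x|.

(* Dau is represented by a subset of V having that cardinality; Dau_spec      *)
(* shows that it is least among all cardinals when V is nonzero (the only     *)
(* case in which Dau is meaningful).                                          *)
Definition Dau : set V := xget set0
  [set D : set V | ~ daugavet_property D /\
     forall D' : set V, ~ daugavet_property D' -> D #<= D'].

End Daugavet.

Arguments unit_ball {R} V.
Arguments unit_sphere {R} V.
Arguments daugavet_property {R} V {T} D.
Arguments Dau {R} V.

Section LeastCardinal.
Variables (V : Type) (P : set (set V)).

(* Injections are built simultaneously: a maximal set G of choice functions   *)
(* on P, pairwise distinct at every member of P, exhausts some member of P.   *)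
Lemma least_cardinal : P !=set0 ->
  exists D, P D /\ forall D', P D' -> D #<= D'.
Proof.
move=> [D0 PD0].
pose good (G : set (set V -> V)) :=
  forall D, P D -> set_fun G D (fun g => g D) /\ set_inj G (fun g => g D).
have [G [Ggood Gmax]] : exists G, good G /\ forall B, G `<` B -> ~ good B.
  apply: Zorn_bigcup => F FP Ftot D PD; split.
    by move=> g [X FX Xg]; apply: (FP X FX D PD).1.
  move=> g h /set_mem[X FX Xg] /set_mem[Y FY Yh] gh.
  have [XY|YX] := Ftot _ _ FX FY.
    by apply: (FP Y FY D PD).2 => //; apply: mem_set => //; exact: XY.
  by apply: (FP X FX D PD).2 => //; apply: mem_set => //; exact: YX.
have [[D [PD Dsub]]|noD] := pselect (exists D, P D /\
    D `<=` [set g D | g in G]).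
  exists D; split=> // D' PD'.
  have /choice[s sP] : forall d, exists g, D d -> G g /\ g D = d.
    move=> d; have [Dd|nDd] := pselect (D d); last by exists (fun=> d).
    by have [g Gg gd] := Dsub _ Dd; exists g.
  apply: (@card_le_trans _ _ _ G).
    apply: inj_card_le; apply: unsquash; apply/injfunPex; exists s.
      by move=> d /sP[].
    move=> d d' /set_mem/sP[_ sd] /set_mem/sP[_ sd'] ss.
    by rewrite -sd -sd' ss.
  have [G1 G2] := Ggood _ PD'.
  by apply: inj_card_le; apply: unsquash; apply/injfunPex; exists (fun g => g D').
have /choice[h hP] : forall D, exists v : V, P D ->
    D v /\ forall g, G g -> g D <> v.
  move=> D.
  have v0 : V.
    suff : exists v : V, True by move/cid => [].
    apply: contrapT => nV; apply: noD; exists D0; split=> // v.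
    by case: nV; exists v.
  have [PD|] := pselect (P D); last by move=> nPD; exists v0.
  apply: contrapT => nv; apply: noD; exists D; split=> // v Dv.
  apply: contrapT => nGv; apply: nv; exists v => _; split=> // g Gg gv.
  by apply: nGv; exists g.
exfalso; apply: (Gmax (G `|` [set h])).
  split; first by move=> g; left.
  move=> /(_ h (or_intror erefl)) Gh.
  by have [_ /(_ h Gh)] := hP _ PD0.
move=> D PD; have [G1 G2] := Ggood _ PD; have [h1 h2] := hP _ PD; split.
  by move=> g [/G1|->].
move=> g g' /set_mem[Gg|->] /set_mem[Gg'|->] //.
- by apply: G2; exact: mem_set.
- by move/h2 => /(_ Gg).
- by move/esym/h2 => /(_ Gg').
Qed.

End LeastCardinal.

Section DauSpec.
Context {R : realType} (V : normedModType R).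

Lemma daugavet_property_fails (v : V) : v != 0 ->
  ~ daugavet_property V (unit_sphere V).
Proof.
move=> v0 /(_ _ (@subset_refl _ _) (card_lexx _) (unit_ball V)).
have slB : is_slice (unit_ball V).
  exists (\0 : {scalar V}), 1; split=> //; first exact: cst_continuous.
  apply/seteqP; split=> [x xB|x []//]; split=> //=.
  have -> : [set (0 : R) | _ in unit_ball V] = [set 0].
    apply/seteqP; split=> [_ [? _ <-]//|_ ->]; exists 0 => //.
    by rewrite /unit_ball/= normr0.
  by rewrite sup1 sub0r ltrN10.
have normK (x : V) : x != 0 -> `| `|x|^-1 *: x | = 1.
  by move=> x0; rewrite normrZ normfV normr_id mulVf// normr_eq0.
move=> /(_ slB 1 ltr01)[x xB].
have [->|x0] := eqVneq x 0.
  by move=> /(_ _ (normK _ v0)); rewrite addr0 normK// ltrBlDr -natr1 ltxx.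
move=> /(_ (- (`|x|^-1 *: x))) /=; rewrite /unit_sphere/= normrN normK//.
move=> /(_ erefl); rewrite ltNge => /negP; apply.
have -> : 2 - 1 = 1 :> R by rewrite -natr1 addrK.
rewrite -[X in _ + X]scale1r -scaleNr -scalerDl normrZ.
have nx : 0 < `|x| by rewrite normr_gt0.
have -> : `| - `|x|^-1 + 1 | = `|x|^-1 - 1.
  rewrite addrC distrC ger0_norm// subr_ge0 invf_ge1//.
rewrite mulrBl mulVf ?gt_eqF// mul1r lerBlDr lerDl; exact: ltW.
Qed.

Lemma daugavet_property_le (T U : Type) (D : set T) (D' : set U) :
  D #<= D' -> daugavet_property V D' -> daugavet_property V D.
Proof. by move=> DD' dD' A A1 /card_le_trans/(_ DD'); exact: dD'. Qed.

Lemma Dau_spec : (exists v : V, v != 0) ->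
  ~ daugavet_property V (Dau V) /\
  forall (T : Type) (D : set T), ~ daugavet_property V D -> Dau V #<= D.
Proof.
move=> [v v0]; rewrite /Dau.
set P := (X in xget _ X); have : P (xget set0 P).
  apply: xgetPex; apply: (@least_cardinal _
    [set D : set V | ~ daugavet_property V D]).
  by exists (unit_sphere V); exact: daugavet_property_fails v0.
move=> [fD minD]; split=> // T D nD.
have [A [A1 AD nA]] : exists A : set V, [/\ A `<=` unit_sphere V, A #<= D &
    ~ daugavet_property V A].
  apply: contrapT => nA; apply: nD => A A1 AD.
  have dA : daugavet_property V A.
    by apply: contrapT => dA; apply: nA; exists A.
  exact: dA.
exact: card_le_trans (minD _ nA) AD.
Qed.

End DauSpec.

(* C(K) with the sup norm; compactness is a parameter of the type because the *)
(* norm is finite only for compact K.                                         *)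
Definition contfun (R : realType) (K : topologicalType)
  (cK : compact [set: K]) : Type := continuousType K R.

Section Contfun.
Context (R : realType) (K : topologicalType) (cK : compact [set: K]).
Local Notation C := (contfun R cK).

HB.instance Definition _ := Choice.copy C (continuousType K R).

Definition contfun_fun (f : C) : K -> R := f : continuousType K R.
Local Coercion contfun_fun : contfun >-> Funclass.

Lemma contfun_continuous (f : C) : continuous f.
Proof. exact: (@cts_fun _ _ (f : continuousType K R)). Qed.

Lemma contfunP (f g : C) : f =1 g -> f = g.
Proof. by move=> fg; apply/continuousEP. Qed.

Definition contfun_of (f : K -> R) (cf : continuous f) : C :=
  (mkcts cf : continuousType K R).

Let add_cts (f g : C) : continuous (fun x => f x + g x).
Proof. by move=> x; apply: cvgD; exact: contfun_continuous. Qed.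
Let opp_cts (f : C) : continuous (fun x => - f x).
Proof. by move=> x; apply: cvgN; exact: contfun_continuous. Qed.
Let scale_cts (a : R) (f : C) : continuous (fun x => a * f x).
Proof. by move=> x; apply: cvgM; [exact: cvg_cst|exact: contfun_continuous]. Qed.
Let zero_cts : continuous (fun _ : K => 0 : R).
Proof. by move=> x; exact: cvg_cst. Qed.

Definition contfun0 : C := contfun_of zero_cts.
Definition contfun_add (f g : C) : C := contfun_of (@add_cts f g).
Definition contfun_opp (f : C) : C := contfun_of (@opp_cts f).
Definition contfun_scale (a : R) (f : C) : C := contfun_of (@scale_cts a f).

Let addA : associative contfun_add.
Proof. by move=> f g h; apply: contfunP => x; exact: addrA. Qed.
Let addC : commutative contfun_add.
Proof. by move=> f g; apply: contfunP => x; exact: addrC. Qed.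
Let add0 : left_id contfun0 contfun_add.
Proof. by move=> f; apply: contfunP => x; exact: add0r. Qed.
Let addN : left_inverse contfun0 contfun_opp contfun_add.
Proof. by move=> f; apply: contfunP => x; exact: addNr. Qed.
HB.instance Definition _ := GRing.isZmodule.Build C addA addC add0 addN.

Let scaleA a b (f : C) :
  contfun_scale a (contfun_scale b f) = contfun_scale (a * b) f.
Proof. by apply: contfunP => x; exact: mulrA. Qed.
Let scale1 : left_id 1 contfun_scale.
Proof. by move=> f; apply: contfunP => x; exact: mul1r. Qed.
Let scaleDr : right_distributive contfun_scale +%R.
Proof. by move=> a f g; apply: contfunP => x; exact: mulrDr. Qed.
Let scaleDl (f : C) : {morph contfun_scale^~ f : a b / a + b}.
Proof. by move=> a b; apply: contfunP => x; exact: mulrDl. Qed.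
HB.instance Definition _ :=
  GRing.Zmodule_isLmodule.Build R C scaleA scale1 scaleDr scaleDl.

(* As sup set0 = 0, the norm is also correct when K is empty.                 *)
Definition contfun_norm (f : C) : R := sup [set `|f x| | x in [set: K]].

Lemma contfun_norm_ub (f : C) (x : K) : `|f x| <= contfun_norm f.
Proof.
apply: ub_le_sup; last by exists x.
have /compact_bounded[M [_ /(_ (M + 1))]] : compact (f @` [set: K]).
  apply: continuous_compact => //; apply: continuous_subspaceT => y.
  exact: contfun_continuous.
rewrite ltrDl ltr01 => /(_ isT) fM; exists (M + 1) => _ [y _ <-].
by apply: fM; exists y.
Qed.

Lemma contfun_norm_le (f : C) (M : R) : 0 <= M ->
  (forall x, `|f x| <= M) -> contfun_norm f <= M.
Proof.
move=> M0 fM; have [K0|/set0P K0] := eqVneq [set: K] set0.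
  by rewrite /contfun_norm K0 image_set0 sup0.
apply: ge_sup; last by move=> _ [x _ <-].
by case: K0 => x _; exists `|f x|, x.
Qed.

Lemma contfun_norm_ge0 (f : C) : 0 <= contfun_norm f.
Proof.
have [K0|/set0P[x _]] := eqVneq [set: K] set0.
  by rewrite /contfun_norm K0 image_set0 sup0.
exact: le_trans (contfun_norm_ub f x).
Qed.

Let normD (f g : C) : contfun_norm (f + g) <= contfun_norm f + contfun_norm g.
Proof.
apply: contfun_norm_le => [|x]; first by rewrite addr_ge0// contfun_norm_ge0.
by rewrite (le_trans (ler_normD (f x) (g x)))// lerD// contfun_norm_ub.
Qed.

Let normZ_le (a : R) (f : C) : contfun_norm (a *: f) <= `|a| * contfun_norm f.
Proof.
apply: contfun_norm_le => [|x]; first by rewrite mulr_ge0// contfun_norm_ge0.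
by rewrite -[leLHS]/(`|a * f x|) normrM ler_wpM2l// contfun_norm_ub.
Qed.

Let normZ (a : R) (f : C) : contfun_norm (a *: f) = `|a| * contfun_norm f.
Proof.
apply/eqP; rewrite eq_le normZ_le /=.
have [->|a0] := eqVneq a 0; first by rewrite normr0 mul0r contfun_norm_ge0.
rewrite -ler_pdivlMl ?normr_gt0//.
by have := normZ_le a^-1 (a *: f); rewrite scalerA mulVf// scale1r normfV.
Qed.

Let norm0_eq0 (f : C) : contfun_norm f = 0 -> f = 0.
Proof.
move=> f0; apply: contfunP => x; apply/eqP.
by rewrite -[_ == _]normr_le0 -f0 contfun_norm_ub.
Qed.

HB.instance Definition _ :=
  Lmodule_isNormed.Build R C normD normZ norm0_eq0.

End Contfun.

Lemma compact_prod (I : Type) (X : I -> topologicalType) :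
  (forall i, compact [set: X i]) -> compact [set: prod_topology X].
Proof.
move: X; elim/Peq : I => I X cX.
suff <- : [set f : prod_topology X | forall i, [set: X i] (f i)] = setT.
  exact: (@tychonoff I X (fun=> setT) cX).
by apply/seteqP; split.
Qed.

(* Main.v *)
(* Let x0 lie in a slice given by f, and let u : K -> [-1, 1] and             *)
(* v_n : K -> [0, 1] be continuous. With P_n = prod_(k < n) (1 - v_k), the    *)
(* sequence w_n = P_n (u - x0) is bounded, so f (w_(n+1)) - f (w_n) is small  *)
(* for some n, and x = x0 + w_n - w_(n+1) is still in the slice: it is the    *)
(* convex combination (1 - h) x0 + h u with h = P_n v_n. It equals u where    *)
(* v_k = 0 for k < n and v_n = 1.                                             *)
(* For each y in the given family, moving coordinates outside some finite set *)
(* changes y very little at a point t where |y| is nearly 1. The family has   *)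
(* fewer than kappa members, so infinitely many coordinates avoid all these   *)
(* finite sets. Let u and each v_n depend on one such coordinate; moving      *)
(* these coordinates of t makes x take the value sign (y t) at a point where  *)
(* y is still close to y t.                                                   *)

Require Import Defs.
From mathcomp Require Import all_boot all_order all_algebra.
From mathcomp Require Import all_classical all_reals all_analysis.
From mathcomp Require Import ring lra.

Set Implicit Arguments.
Unset Strict Implicit.
Unset Printing Implicit Defensive.

Import Order.TTheory GRing.Theory Num.Theory.
Import numFieldNormedType.Exports.

Local Open Scope classical_set_scope.
Local Open Scope card_scope.
Local Open Scope ring_scope.

(** If kappa were not at most [Dau], C(K) would fail the Daugavet property for a set not of size at
    least kappa, against [product_daugavet]. The functional of the slice enters only through its
    boundedness: along a bounded sequence some increment is small, so one of infinitely many
    candidates for x stays in the slice ([slice_interpolation]). The product enters through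
    [product_continuous_finite] and the count in [card_le_bigcup_finite]: fewer than kappa finite
    sets leave infinitely many coordinates free. *)

(** * Infinite cardinals and covers by finite sets *)

Lemma infinite_set_injective_seq (T : Type) (A : set T) :
  infinite_set A -> exists2 s : nat -> T, forall n, A (s n) & injective s.
Proof.
move=> /infiniteP/card_leP[g].
exists (fun n => val (g (SigSub (mem_set I : n \in [set: nat])))) => [n|m n].
  by apply: set_mem; exact: valP.
by move=> /val_inj/inj; rewrite !in_setT => /(_ isT isT)/(congr1 val).
Qed.

(* A maximal family G of injective sequences in A with disjoint ranges covers *)
(* A up to a finite set B, which is coded by odd indices of one member of G.  *)
Lemma card_le_setX_nat (T : Type) (A : set T) :
  infinite_set A -> A `*` [set: nat] #<= A.
Proof.
move=> infA.
pose good (G : set (nat -> T)) := (forall g n, G g -> A (g n)) /\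
  forall g h m n, G g -> G h -> g m = h n -> g = h /\ m = n.
have [G [[GA Ginj] Gmax]] : exists G, good G /\ forall B, G `<` B -> ~ good B.
  apply: Zorn_bigcup => F FP Ftot; split=> [g n [Y FY Yg]|].
    exact: (FP Y FY).1.
  move=> g h m n [Y FY Yg] [Z FZ Zh].
  have [YZ|ZY] := Ftot _ _ FY FZ.
    by apply: (FP Z FZ).2 => //; exact: YZ.
  by apply: (FP Y FY).2 => //; exact: ZY.
pose B := [set a | A a /\ forall g n, G g -> g n <> a].
have finB : finite_set B.
  apply: contrapT => /infinite_set_injective_seq[h hB hinj].
  apply: (Gmax (G `|` [set h])); first split=> [g Gg|/(_ h (or_intror erefl))].
  - by left.
  - by move=> /(fun Gh => (hB 0).2 h 0%N Gh); exact.
  split=> [g n [/GA//|->]|g g' m n]; first exact: (hB n).1.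
  move=> [Gg|->] [Gg'|->]; first exact: Ginj.
  - by move=> gh; case: ((hB n).2 g m).
  - by move=> /esym gh; case: ((hB m).2 g' n).
  - by move=> /hinj ->.
have [g0 Gg0] : G !=set0.
  apply/set0P/eqP => G0; apply: infA; apply: sub_finite_set finB => a Aa.
  by split=> // g n; rewrite G0.
have /pcard_injP[c cinj] := finite_set_countable finB.
have /choice[phi phiP] : forall a, exists p : (nat -> T) * nat,
    G p.1 /\ (A a -> if `[< B a >] then p = (g0, (c a).*2.+1)
                     else exists2 m, p.2 = m.*2 & p.1 m = a).
  move=> a; have [Aa|] := pselect (A a); last by exists (g0, 0%N).
  case: asboolP => Ba; first by exists (g0, (c a).*2.+1).
  have [g [m [Gg gma]]] : exists g m, G g /\ g m = a.
    apply: contrapT => nga; apply: Ba; split=> // g m Gg gma.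
    by apply: nga; exists g, m.
  by exists (g, m.*2); split=> // _; exists m.
have phi_inj a b : A a -> A b -> phi a = phi b -> a = b.
  move=> Aa Ab ab; have [_ /(_ Aa)] := phiP a; have [_ /(_ Ab)] := phiP b.
  rewrite -ab; case: asboolP => Bb; case: asboolP => Ba.
  - move=> ea; rewrite ea => -[/double_inj cba].
    by apply: cinj; [exact: mem_set|exact: mem_set|].
  - by move=> -> [m /(congr1 odd)] /=; rewrite !odd_double.
  - move=> [m em _] ea; move: em; rewrite ea => /(congr1 odd) /=.
    by rewrite !odd_double.
  - by move=> [m em eb] [n]; rewrite em => /double_inj <-; rewrite eb.
apply: inj_card_le; apply: unsquash; apply/injfunPex.
(* The position of a in its sequence and the number m are packed into one index of the same
   sequence. *)
exists (fun p => (phi p.1).1 (pickle ((phi p.1).2, p.2))).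
  by move=> p _; apply: GA; have [] := phiP p.1.
move=> [a m] [b n] /set_mem[/= Aa _] /set_mem[/= Ab _] E.
have [] := Ginj _ _ _ _ (phiP a).1 (phiP b).1 E.
move=> e1 /(pcan_inj pickleK)[e2 ->].
by rewrite (@phi_inj a b)//; case: (phi a) (phi b) e1 e2 => ? ? [? ?] /= -> ->.
Qed.

(** Send i to a [y] with i in [F y], paired with the number of i in an enumeration of [F y]; [A] is
    infinite, so it absorbs the factor nat. *)
Lemma card_le_bigcup_finite (T U : Type) (A : set T) (F : T -> set U)
    (D : set U) :
  infinite_set D -> (forall y, A y -> finite_set (F y)) ->
  D `<=` \bigcup_(y in A) F y -> D #<= A.
Proof.
move=> infD finF DF.
have infA : infinite_set A.
  by move=> finA; apply: infD; apply: sub_finite_set DF _; exact: bigcup_finite.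
apply: card_le_trans (card_le_setX_nat infA).
have [y0 Ay0] := infinite_setN0 infA.
have /choice[y yP] : forall i, exists y, A y /\ (D i -> F y i).
  move=> i; have [/DF[y Ay Fyi]|] := pselect (D i); first by exists y.
  by exists y0.
have /choice[c cP] : forall y, exists c : U -> nat,
    A y -> {in F y &, injective c}.
  move=> z; have [Az|] := pselect (A z); last by exists (fun=> 0%N).
  by have /pcard_injP[c] := finite_set_countable (finF _ Az); exists c.
apply: inj_card_le; apply: unsquash; apply/injfunPex.
exists (fun i => (y i, c (y i) i)).
  by move=> i _; split=> //; case: (yP i).
move=> i j /set_mem Di /set_mem Dj [yij]; rewrite -yij.
have [Ay /(_ Di) Fi] := yP i; have [_ /(_ Dj) Fj] := yP j.
by apply: cP => //; rewrite inE// yij.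
Qed.

(** * Bounded functionals and slices *)

(** Increments all at least [d] would give linear growth. *)
Lemma bounded_small_increment (R : realType) (c : nat -> R) (M d : R) :
  (forall n, `|c n| <= M) -> 0 < d -> exists n, c n.+1 - c n < d.
Proof.
move=> cM d0; apply: contrapT => nc.
have cge n : c 0%N + d *+ n <= c n.
  elim: n => [|n IH]; first by rewrite addr0.
  have : d <= c n.+1 - c n.
    by rewrite leNgt; apply/negP => cd; apply: nc; exists n.
  by rewrite mulrSr; lra.
have : (M + M) / d < (Num.truncn ((M + M) / d)).+1%:R by exact: truncnS_gt.
set N := _.+1; rewrite ltr_pdivrMr// mulr_natl => MN.
have := cge N; have := cM N; have := cM 0%N.
by rewrite !ler_norml => /andP[h1 _] /andP[_ h2] h3; lra.
Qed.

Lemma scalar_bounded (R : realType) (V : normedModType R) (f : {scalar V})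
    (r : R) : continuous (f : V -> R) ->
  exists M, forall x, `|x| <= r -> `|f x| <= M.
Proof.
move=> /linear_bounded_continuous/linear_boundedP[b [_ /(_ (`|b| + 1))]].
rewrite (le_lt_trans (ler_norm b)) ?ltrDl// => /(_ isT) fb.
exists ((`|b| + 1) * r) => x xr; apply: le_trans (fb x) _.
by rewrite ler_wpM2l.
Qed.

Lemma slice_near (R : realType) (V : normedModType R) (S : set V) :
  is_slice S -> exists f : {scalar V}, exists x0 d, [/\ continuous (f : V -> R),
    0 < d, `|x0| <= 1 & forall x, `|x| <= 1 -> f x0 - d < f x -> S x].
Proof.
move=> [f [a [cf a0 ->]]]; set B := [set f y | y in unit_ball V].
have [x0 x01 fx0] : exists2 x0, `|x0| <= 1 & sup B - a < f x0.
  (* Without a supremum, [sup B] is 0 by default and the origin serves as [x0]. *)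
  have [supB|/sup_out ->] := pselect (has_sup B).
    by have [_ [x x1 <-]] := sup_adherent a0 supB; exists x.
  by exists 0; rewrite ?normr0// linear0 sub0r oppr_lt0.
exists f, x0, (f x0 - (sup B - a)); split=> //; first by rewrite subr_gt0.
by move=> x x1; rewrite subKr.
Qed.

(** * Interpolation inside a slice of the ball of C(K) *)

Section Contfun.
Context (R : realType) (K : topologicalType) (cK : compact [set: K]).
Local Notation C := (contfun R cK).

Lemma contfun_normP (f : C) (M : R) : 0 <= M ->
  `|f| <= M <-> forall x, `|contfun_fun f x| <= M.
Proof.
move=> M0; split=> [fM x|]; last exact: contfun_norm_le.
exact: le_trans (contfun_norm_ub f x) fM.
Qed.

Lemma contfun_norm_gt (f : C) (M : R) : 0 <= M -> M < `|f| ->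
  exists x, M < `|contfun_fun f x|.
Proof.
move=> M0; apply: contraPP => nf; apply/negP; rewrite -leNgt.
apply/contfun_normP => // x; rewrite leNgt; apply/negP => fx.
by apply: nf; exists x.
Qed.

(** The index n depends on the slice but not on t, so one x serves for all points t, hence for all
    members of the family. *)
Lemma slice_interpolation (S : set C) (u : K -> R) (v : nat -> K -> R) :
  is_slice S -> continuous u -> (forall t, `|u t| <= 1) ->
  (forall n, continuous (v n)) -> (forall n t, 0 <= v n t <= 1) ->
  exists2 x : C, S x & exists n, forall t,
    (forall k, (k < n)%N -> v k t = 0) -> v n t = 1 -> contfun_fun x t = u t.
Proof.
move=> slS cu u1 cv v01; have [f [x0 [d [cf d0 x01 Sf]]]] := slice_near slS.
have x0t t : `|contfun_fun x0 t| <= 1 by apply/contfun_normP: t.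
pose P n t := \prod_(k < n) (1 - v k t).
have PS n t : P n.+1 t = P n t * (1 - v n t) by rewrite /P big_ord_recr.
have P01 n t : 0 <= P n t <= 1.
  rewrite /P prodr_ge0 ?prodr_ile1// => k _; have := v01 k t; lra.
have cP n : continuous (P n).
  elim: n => [|n IH] t.
    rewrite (_ : P 0%N = fun=> 1); first exact: cvg_cst.
    by apply/funext => s; rewrite /P big_ord0.
  rewrite (_ : P n.+1 = fun s => P n s * (1 - v n s)); last exact/funext/PS.
  by apply: cvgM; [exact: IH|apply: cvgB; [exact: cvg_cst|exact: cv]].
have cw n : continuous (fun t => P n t * (u t - contfun_fun x0 t)).
  move=> t; apply: cvgM; first exact: cP.
  by apply: cvgB; [exact: cu|exact: contfun_continuous].
pose w n : C := contfun_of cK (cw n).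
have w2 n : `|w n| <= 2.
  apply/contfun_normP => // t.
  rewrite -[leLHS]/`|P n t * (u t - contfun_fun x0 t)| normrM.
  have := P01 n t; have := u1 t; have := x0t t; rewrite !ler_norml.
  move=> x0t1 ut1 Pt; rewrite ger0_norm; last by case/andP: Pt.
  rewrite -[2]mul1r ler_pM//; first by case/andP: Pt.
    by case/andP: Pt.
  by rewrite ler_norml; lra.
have [M fM] := scalar_bounded 2 cf.
have [n fn] := bounded_small_increment (fun n => fM _ (w2 n)) d0.
have xE t : contfun_fun (x0 + (w n - w n.+1)) t =
    contfun_fun x0 t + P n t * v n t * (u t - contfun_fun x0 t).
  rewrite -[LHS]/(contfun_fun x0 t + (P n t * (u t - contfun_fun x0 t)
    - P n.+1 t * (u t - contfun_fun x0 t))) PS; ring.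
exists (x0 + (w n - w n.+1)).
  apply: Sf; last by rewrite linearD linearB; lra.
  apply/contfun_normP => // t; rewrite xE.
  have /andP[h0 h1] : 0 <= P n t * v n t <= 1.
    have /andP[? ?] := P01 n t; have /andP[? ?] := v01 n t.
    by rewrite mulr_ge0// mulr_ile1.
  have := u1 t; have := x0t t; rewrite !ler_norml => /andP[a1 a2] /andP[b1 b2].
  by apply/andP; split; nra.
exists n => t vk0 vn1; rewrite xE vn1 /P big1 => [|k _]; first by ring.
by rewrite vk0 ?subr0.
Qed.

End Contfun.

(** * Products of compact spaces *)

Lemma product_continuous_finite (R : realType) (I : Type)
    (X : I -> topologicalType) (f : prod_topology X -> R)
    (t : prod_topology X) (e : R) : {for t, continuous f} -> 0 < e ->
  exists2 F : set I, finite_set F &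
    forall s, (forall i, F i -> s i = t i) -> `|f t - f s| < e.
Proof.
move=> cf e0.
(* G converges to t, as each coordinate is eventually constant along it. *)
pose G : set_system (prod_topology X) := filter_from finite_set
  (fun F => [set s | forall i, F i -> s i = t i]).
have GF : Filter G.
  apply: filter_from_filter; first by exists set0.
  move=> F1 F2 fF1 fF2; exists (F1 `|` F2); first by rewrite finite_setU.
  by move=> s sF; split=> i Fi; apply: sF; [left|right].
have Gt : G --> t.
  apply/cvg_sup => i A [_ [[B oB <-] Bt] /filterS]; apply.
  exists [set i]; first exact: finite_set1.
  by move=> s /(_ i erefl) /= ->.
have [F fF Fs] : G [set s | `|f t - f s| < e].
  have fG : f @ G --> f t by apply: cvg_comp Gt cf.
  by move/cvgrPdist_lt : fG => /(_ _ e0).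
by exists F.
Qed.

Lemma prod_topology_eval_continuous (I : Type) (X : I -> topologicalType)
    (i : I) : continuous (fun t : prod_topology X => t i).
Proof. by move: X i; elim/Peq : I => I X i; exact: proj_continuous. Qed.

(** Urysohn's lemma for two points, since compact Hausdorff spaces are normal. *)
Lemma compact_hausdorff_separator (R : realType) (X : topologicalType)
    (a b : X) : hausdorff_space X -> compact [set: X] -> a <> b ->
  exists p : X -> R,
    [/\ continuous p, forall x, 0 <= p x <= 1, p a = 0 & p b = 1].
Proof.
move=> hX cX ab.
have /(@uniform_separatorP _ R)[p [cp p01 pa pb]] :
    uniform_separator [set a] [set b].
  apply: (@normal_completely_regular R _ (compact_normal hX cX)).
    exact: hausdorff_accessible.
  exact: accessible_closed_set1 (hausdorff_accessible hX) _.
  exact: ab.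
exists p; split=> //; [|by apply: pa; exists a|by apply: pb; exists b].
by move=> x; have := p01 (p x) (imageT _ _); rewrite /= in_itv.
Qed.

Lemma product_daugavet (R : realType) (I : Type) (X : I -> topologicalType)
    (cK : compact [set: prod_topology X]) (T : Type) (D : set T) :
  infinite_set [set: I] ->
  (forall i, hausdorff_space (X i)) -> (forall i, compact [set: X i]) ->
  (forall i, exists x y : X i, x <> y) ->
  ~~ ([set: I] #<= D) -> daugavet_property (contfun R cK) D.
Proof.
move=> infI hausX cptX twoX ID A A1 AD S slS e e0.
have /choice[F FP] : forall y : contfun R cK, exists F : set I, finite_set F /\
    (A y -> exists2 t, 1 - e / 2 < `|contfun_fun y t| & forall s,
      (forall i, F i -> s i = t i) ->
      `|contfun_fun y t - contfun_fun y s| < e / 2).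
  move=> y; have [Ay|] := pselect (A y); last by exists set0.
  (* The maximum with 0 covers the case [e] > 2, where [1 - e / 2] is negative. *)
  have [||t] := @contfun_norm_gt _ _ _ y (Num.max 0 (1 - e / 2)).
  - by rewrite le_max lexx.
  - by rewrite (A1 _ Ay) gt_max ltr01/=; lra.
  rewrite gt_max => /andP[_ yt].
  have e20 : 0 < e / 2 by rewrite divr_gt0.
  have [F fF yF] :=
    product_continuous_finite (@contfun_continuous _ _ _ y t) e20.
  by exists F; split=> // _; exists t.
(* If only finitely many coordinates were free, adding them to each [F y] would cover the index set
   by finite sets indexed by [A]. If [A] is empty, all coordinates are free. *)
have infJ : infinite_set (~` \bigcup_(y in A) F y).
  move=> finJ; have [[y0 Ay0]|A0] := pselect (A !=set0); last first.
    apply: infI; apply: sub_finite_set finJ => i _ [y Ay _].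
    by apply: A0; exists y.
  move/negP : ID; apply; apply: card_le_trans AD.
  apply: (@card_le_bigcup_finite _ _ A
      (fun y => F y `|` ~` \bigcup_(y in A) F y)) => //.
    by move=> y _; rewrite finite_setU; split=> //; have [] := FP y.
  move=> i _; have [[y Ay Fi]|nFi] := pselect ((\bigcup_(y in A) F y) i).
    by exists y => //; left.
  by exists y0 => //; right.
have [s sJ sinj] := infinite_set_injective_seq infJ.
have sep i : {q : (X i -> R) * (X i * X i) | [/\ continuous q.1,
    forall x, 0 <= q.1 x <= 1, q.1 q.2.1 = 0 & q.1 q.2.2 = 1]}.
  apply: cid; have [a [b ab]] := twoX i.
  have [p [cp p01 pa pb]] :=
    compact_hausdorff_separator R (hausX i) (cptX i) ab.
  by exists (p, (a, b)).
pose q n (t : prod_topology X) := (sval (sep (s n))).1 (t (s n)).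
have cq n : continuous (q n).
  have [cp _ _ _] := svalP (sep (s n)) => t.
  apply: (@continuous_comp _ _ _ (fun t : prod_topology X => t (s n))).
    exact: prod_topology_eval_continuous.
  exact: cp.
have q01 n t : 0 <= q n t <= 1 by have [_ + _ _] := svalP (sep (s n)); exact.
(* Coordinate [s 0] carries u, rescaled to [-1, 1]; v_n uses [s n.+1], hence the shift. *)
have [||||x Sx [n xn]] := @slice_interpolation _ _ cK S
  (fun t => 2 * q 0%N t - 1) (fun n => q n.+1) slS.
- suff affine (K : topologicalType) (p : K -> R) : continuous p ->
      continuous (fun t => 2 * p t - 1) by apply: affine; exact: cq.
  move=> cp t; apply: cvgB; last exact: cvg_cst.
  by apply: cvgM; [exact: cvg_cst|exact: cp].
- by move=> t; rewrite ler_norml; have := q01 0%N t; lra.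
- by move=> m; exact: cq.
- by move=> m t; exact: q01.
exists x => // y Ay.
have [_ /(_ Ay)[t yt Ft]] := FP y.
(* On the coordinates [s m], put 1 at [s n.+1], the sign of y t at [s 0] and 0 elsewhere, as values
   of [q]; all coordinates in [F y] are kept. *)
pose t' : prod_topology X := fun i =>
  if `[< exists m, i = s m >] then
    if `[< i = s n.+1 \/ i = s 0%N /\ 0 <= contfun_fun y t >]
    then (sval (sep i)).2.2 else (sval (sep i)).2.1
  else t i.
pose high m := m = n.+1 \/ m = 0%N /\ 0 <= contfun_fun y t.
have t'_high m : high m -> q m t' = 1.
  move=> mh; rewrite /q /t'; case: asboolP => [_|[]]; last by exists m.
  case: asboolP => [_|[]]; last by case: mh => [->|[-> ?]]; [left|right].
  by have [] := svalP (sep (s m)).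
have t'_low m : ~ high m -> q m t' = 0.
  move=> mh; rewrite /q /t'; case: asboolP => [_|[]]; last by exists m.
  case: asboolP => [[/sinj ?|[/sinj ? ?]]|_]; [by case: mh; left| |].
    by case: mh; right.
  by have [] := svalP (sep (s m)).
have {xn} xt' : contfun_fun x t' = 2 * q 0%N t' - 1.
  apply: xn => [k kn|]; last by apply: t'_high; left.
  by apply: t'_low => -[[kE]|[]//]; rewrite kE ltnn in kn.
have {Ft} yt' : `|contfun_fun y t - contfun_fun y t'| < e / 2.
  apply: Ft => i Fi; rewrite /t'; case: asboolP => // -[m im].
  by case: (sJ m); exists y => //; rewrite -im.
apply: lt_le_trans (contfun_norm_ub (y + x) t').
rewrite -[ltRHS]/`|contfun_fun y t' + contfun_fun x t'| xt'.
(* y t' lies within [e / 2] of y t, whose modulus exceeds [1 - e / 2], and x t' is the sign of y t,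
   so the sum exceeds [2 - e] in modulus. *)
move: yt yt'; have [y0|/negP y0] := boolP (0 <= contfun_fun y t).
  rewrite t'_high; last by right.
  by rewrite ger0_norm// ltr_norml lter_normr => yt /andP[h1 h2]; lra.
rewrite t'_low; last by case=> [//|[]].
rewrite ler0_norm; last by move/negP : y0; rewrite -ltNge => /ltW.
by rewrite ltr_norml lter_normr => yt /andP[h1 h2]; lra.
Qed.

Theorem corollary5p9 (R : realType) (I : Type) (X : I -> topologicalType)
  (infI : infinite_set [set: I])
  (hausX : forall i, hausdorff_space (X i))
  (cptX : forall i, compact [set: X i])
  (twoX : forall i, exists x y : X i, x <> y) :
  [set: I] #<= Dau (contfun R (compact_prod cptX)).
Proof.
apply: contrapT => /negP IDau.
(* C(K) is nonzero: the constant 1 does not vanish at a point of K. *)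
have [|nDau _] := @Dau_spec _ (contfun R (compact_prod cptX)).
  have K0 i : {x : X i | True}.
    by apply: cid; have [x _] := twoX i; exists x.
  have cont1 : continuous (fun _ : prod_topology X => 1 : R).
    exact: cst_continuous.
  exists (contfun_of (compact_prod cptX) cont1).
  apply/eqP => /(congr1 (fun f : contfun R (compact_prod cptX) =>
    contfun_fun f (fun i => sval (K0 i)))).
  by apply/eqP; exact: oner_neq0.
by apply: nDau; exact: product_daugavet.
Qed.
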